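(* Let $\Gamma_1$ and $\Gamma_2$ be ordered point clouds of length $n$ in a metric space $(X,d)$. Let $\varepsilon=d_\infty(\Gamma_1,\Gamma_2)$. Then for every $r\ge 0$, $$\mathrm{DC}_r(\Gamma_1)\subset\mathrm{DC}_{r+\varepsilon}(\Gamma_2)\qquad\text{and}\qquad\mathrm{DC}_r(\Gamma_2)\subset\mathrm{DC}_{r+\varepsilon}(\Gamma_1).$$
   Context: An ordered point cloud of length $n$ is a finite indexed family $\Gamma=(x_1,\dots,x_n)$ of (not necessarily distinct) points of $X$. For $\Gamma=(x_1,\dots,x_n)$ and $\Gamma'=(x'_1,\dots,x'_n)$, $d_\infty(\Gamma,\Gamma')=\max_{1\le i\le n}d(x_i,x'_i)$. $B(x,r)=\{y\in X\mid d(x,y)<r\}$ is the open ball. Čech complex: $\check{\mathrm C}_r(\Gamma)$ is the simplicial complex whose simplices are the nonempty $\sigma\subset\{1,\dots,n\}$ with $\bigcap_{i\in\sigma}B(x_i,r)\neq\emptyset$. Elementary cubes in $\mathbb{R}^2$ are products $I_1\times I_2$ with each $I_m$ of the form $[k,k]$ or $[k,k+1]$, $k\in\mathbb{Z}$. Distance complex: $\mathrm{DC}_r(\Gamma)$ is the set (cubical complex) of all elementary cubes $[i,j]\times[k,l]\subset[1,n]^2$ (so $j\in\{i,i+1\}$, $l\in\{k,k+1\}$) with $j\le k$ and $\{i,j,k,l\}\in\check{\mathrm C}_r(\Gamma)$. *)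

(* Defs.v *)
From mathcomp Require Import all_boot all_order all_algebra.
From mathcomp Require Import all_classical all_reals all_analysis.

Set Implicit Arguments.
Unset Strict Implicit.
Unset Printing Implicit Defensive.

Import Order.TTheory GRing.Theory Num.Theory.

Local Open Scope classical_set_scope.
Local Open Scope ring_scope.

(* In the 1-based notation (x_1, ..., x_n) the element i of 'I_n stands for the
   index i.+1, see [label]. *)
Definition point_cloud (n : nat) (X : Type) := 'I_n -> X.

(* The maximum is taken over nonnegative reals; it is 0 when n = 0. *)
Definition dinf (R : realType) (X : metricType R) (n : nat)
    (G G' : point_cloud n X) : R :=
  \big[Num.max/0]_(i < n) mdist (G i) (G' i).

(* By [ballEmdist], [ball x r] is [set y | mdist x y < r] for every real r. *)
Definition cech (R : realType) (X : metricType R) (n : nat) (r : R)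
    (G : point_cloud n X) : set {set 'I_n} :=
  [set s | s != finset.set0 /\ \bigcap_(i in [set` s]) ball (G i) r !=set0].

Definition elementary_interval (R : realType) (I : set R) : Prop :=
  exists k : int,
    I = `[k%:~R, k%:~R]%classic \/ I = `[k%:~R, (k + 1)%:~R]%classic.

Definition elementary_cube (R : realType) (Q : set (R * R)) : Prop :=
  exists I1 I2 : set R,
    [/\ elementary_interval I1, elementary_interval I2 & Q = I1 `*` I2].

Definition label (R : realType) (n : nat) (i : 'I_n) : R := (i.+1)%:R.

(* The labels range over {1, ..., n}, so the cubes lie in [1, n]^2. Elementarity
   together with i <= j and k <= l forces j \in {i, i+1} and l \in {k, k+1}. *)
Definition distance_complex (R : realType) (X : metricType R) (n : nat) (r : R)
    (G : point_cloud n X) : set (set (R * R)) :=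
  [set Q | elementary_cube Q /\
    exists i j k l : 'I_n,
      [/\ (i <= j)%N /\ (k <= l)%N,
          Q = `[label R i, label R j]%classic `*`
              `[label R k, label R l]%classic,
          (j <= k)%N
        & cech r G [set i; j; k; l]%SET]].

(* Main.v *)
Require Import Defs.
From mathcomp Require Import all_boot all_order all_algebra.
From mathcomp Require Import all_classical all_reals all_analysis.

Import Order.TTheory GRing.Theory Num.Theory.

Local Open Scope classical_set_scope.
Local Open Scope ring_scope.

(** The cube attached to indices [i, j, k, l] is the same set for every point
    cloud, so only the condition that these indices span a Čech simplex has to
    be transported from one cloud to the other. A point [y] witnessing it for
    [G] at radius [r] lies within [r] of each of the relevant points of [G], and
    each of these is within [dinf G G'] of its counterpart in [G'], so by the
    triangle inequality the same [y] is a witness for [G'] at radius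
    [r + dinf G G'] ([cech_sub_dinf]). The second inclusion is the first with
    the clouds exchanged, as [dinf] is symmetric ([dinfC]). *)

Lemma mdist_le_dinf (R : realType) (X : metricType R) (n : nat)
    (G G' : point_cloud n X) (i : 'I_n) : mdist (G i) (G' i) <= dinf G G'.
Proof. exact: (le_bigmax _ (fun i => mdist (G i) (G' i))). Qed.

Lemma dinfC (R : realType) (X : metricType R) (n : nat)
    (G G' : point_cloud n X) : dinf G G' = dinf G' G.
Proof. by apply: eq_bigr => i _; rewrite metric_sym. Qed.

Lemma cech_sub_dinf (R : realType) (X : metricType R) (n : nat) (r : R)
    (G G' : point_cloud n X) : cech r G `<=` cech (r + dinf G G') G'.
Proof.
move=> s [s_neq0 [y ys]]; split=> //; exists y => i si.
move: (ys i si); rewrite !ballEmdist /= => yi.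
apply: le_lt_trans (metric_triangle _ (G i) _) _.
by rewrite addrC ltr_leD// metric_sym mdist_le_dinf.
Qed.

Lemma distance_complex_sub_dinf (R : realType) (X : metricType R) (n : nat)
    (r : R) (G G' : point_cloud n X) :
  distance_complex r G `<=` distance_complex (r + dinf G G') G'.
Proof.
move=> Q [Qcube [i [j [k [l [ijkl Qijkl jk simplex]]]]]]; split=> //.
by exists i, j, k, l; split=> //; apply: cech_sub_dinf simplex.
Qed.

Theorem lemma3p5 (R : realType) (X : metricType R) (n : nat)
    (G1 G2 : point_cloud n X) (r : R) (r_ge0 : 0 <= r) :
  distance_complex r G1 `<=` distance_complex (r + dinf G1 G2) G2 /\
  distance_complex r G2 `<=` distance_complex (r + dinf G1 G2) G1.
Proof.
split; first exact: distance_complex_sub_dinf.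
by rewrite dinfC; apply: distance_complex_sub_dinf.
Qed.
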